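(* Let $p\geq 3$ and $k\geq 1$ be integers. Let $\mathcal{G}$ be the class of $K_p$-free graphs of treedepth at most $k$. Then the defective chromatic number of $\mathcal{G}$, the clustered chromatic number of $\mathcal{G}$, and the chromatic number of $\mathcal{G}$ are equal.
   Context: Graphs are finite, simple and undirected. A graph is $K_p$-free if it has no subgraph isomorphic to the complete graph $K_p$. A $k$-colouring of a graph assigns one of at most $k$ colours to each vertex (not necessarily properly). A monochromatic component is a connected component of the subgraph induced by all vertices of a single colour. A colouring has defect $d$ if every monochromatic component has maximum degree at most $d$, and has clustering $c$ if every monochromatic component has at most $c$ vertices. For a graph class $\mathcal{G}$: the chromatic number of $\mathcal{G}$ is $\max\{\chi(G):G\in\mathcal{G}\}$, where $\chi(G)$ is the usual (proper) chromatic number; the defective chromatic number of $\mathcal{G}$ is the minimum integer $k$ for which there exists an integer $d$ such that every graph in $\mathcal{G}$ is $k$-colourable with defect $d$; the clustered chromatic number of $\mathcal{G}$ is the minimum integer $k$ for which there exists an integer $c$ such that every graph in $\mathcal{G}$ is $k$-colourable with clustering $c$. (Each is called unbounded if the relevant maximum or minimum does not exist.) In a rooted tree, the depth of a vertex $v$ is the number of vertices on the path from the root to $v$; the depth of a rooted forest is the maximum depth of its vertices; the closure of a rooted forest $F$ is the graph on $V(F)$ in which two distinct vertices are adjacent if and only if one is an ancestor of the other. The treedepth of a graph $G$ is the minimum depth of a rooted forest $F$ such that $G$ is a spanning subgraph of the closure of $F$. *)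

(* Defs.v *)
From mathcomp Require Import all_boot.
Set Implicit Arguments.
Unset Strict Implicit.
Unset Printing Implicit Defensive.

Definition is_min (P : nat -> Prop) (n : nat) : Prop :=
  P n /\ forall m, P m -> n <= m.

Definition is_max (P : nat -> Prop) (n : nat) : Prop :=
  P n /\ forall m, P m -> m <= n.

Record sgraph := SGraph {
  vertex :> finType;
  adj : rel vertex;
  adj_sym : symmetric adj;
  adj_irr : irreflexive adj }.

Lemma neq_sym (T : eqType) : symmetric (fun x y : T => x != y).
Proof. by move=> x y; rewrite eq_sym. Qed.

Lemma neq_irr (T : eqType) : irreflexive (fun x y : T => x != y).
Proof. by move=> x; rewrite eqxx. Qed.

Definition complete_graph (p : nat) : sgraph :=
  SGraph (@neq_sym 'I_p) (@neq_irr 'I_p).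

(** Not necessarily induced: [f] need not reflect adjacency. *)
Definition has_subgraph_isomorphic_to (H G : sgraph) : Prop :=
  exists2 f : H -> G, injective f & forall x y, adj x y -> adj (f x) (f y).

Definition Kfree (p : nat) (G : sgraph) : Prop :=
  ~ has_subgraph_isomorphic_to (complete_graph p) G.

Definition colouring (G : sgraph) (k : nat) := {ffun G -> 'I_k}.

Section Colourings.
Variable G : sgraph.

Definition proper k (c : colouring G k) : bool :=
  [forall u : G, forall v : G, adj u v ==> (c u != c v)].

Lemma proper_colouring_exists :
  exists k, [exists c : colouring G k, proper c].
Proof.
exists #|G|; apply/existsP; exists [ffun v => enum_rank v].
apply/forallP=> u; apply/forallP=> v; apply/implyP=> uv.
rewrite !ffunE (inj_eq enum_rank_inj).
by apply: contraTneq uv => ->; rewrite adj_irr.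
Qed.

Definition chi : nat := ex_minn proper_colouring_exists.

Definition colour_class k (c : colouring G k) (i : 'I_k) : {set G} :=
  [set v | c v == i].

(** Edges of the subgraph induced by [A], as a relation on all of [G]. *)
Definition induced_adj (A : {set G}) : rel G :=
  [rel u v | [&& u \in A, v \in A & adj u v]].

(** Vertex sets of the connected components of the subgraph induced by [A]. *)
Definition components (A : {set G}) : {set {set G}} :=
  equivalence_partition (connect (induced_adj A)) A.

Definition monochromatic_component k (c : colouring G k) (C : {set G}) : Prop :=
  exists i : 'I_k, C \in components (colour_class c i).

Definition max_degree_in (C : {set G}) : nat :=
  \max_(v in C) #|[set u in C | adj v u]|.

Definition has_defect k (c : colouring G k) (d : nat) : Prop :=
  forall C, monochromatic_component c C -> max_degree_in C <= d.

Definition has_clustering k (c : colouring G k) (s : nat) : Prop :=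
  forall C, monochromatic_component c C -> #|C| <= s.

End Colourings.

Definition graph_class := sgraph -> Prop.

Definition chromatic_number (cls : graph_class) (n : nat) : Prop :=
  is_max (fun m => exists2 G, cls G & chi G = m) n.

Definition defective_chromatic_number (cls : graph_class) (n : nat) : Prop :=
  is_min (fun k => exists d, forall G, cls G ->
            exists c : colouring G k, has_defect c d) n.

Definition clustered_chromatic_number (cls : graph_class) (n : nat) : Prop :=
  is_min (fun k => exists s, forall G, cls G ->
            exists c : colouring G k, has_clustering c s) n.

(** A rooted forest with vertex set [T] is given by its parent function
    [F], where [F v = None] means that [v] is a root. *)
Section RootedForests.
Variable T : finType.
Implicit Type F : {ffun T -> option T}.

Definition parent_rel F : rel T := [rel x y | F x == Some y].

Definition rooted_forest F : bool :=
  [forall x, forall y, parent_rel F x y ==> ~~ connect (parent_rel F) y x].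

(** Reflexive: the ancestors of [v] are exactly the vertices of the path
    from the root to [v], including [v]. *)
Definition ancestor F (u v : T) : bool := connect (parent_rel F) v u.

Definition vertex_depth F (v : T) : nat := #|[set u | ancestor F u v]|.

Definition forest_depth F : nat := \max_(v : T) vertex_depth F v.

Definition closure_adj F : rel T :=
  [rel u v | (u != v) && (ancestor F u v || ancestor F v u)].

Lemma closure_sym F : symmetric (closure_adj F).
Proof. by move=> u v; rewrite /closure_adj /= eq_sym orbC. Qed.

Lemma closure_irr F : irreflexive (closure_adj F).
Proof. by move=> u; rewrite /closure_adj /= eqxx. Qed.

Definition forest_closure F : sgraph := SGraph (closure_sym F) (closure_irr F).

End RootedForests.

Section Treedepth.
Variable G : sgraph.

Definition spanning_in_closure (F : {ffun G -> option G}) : bool :=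
  [forall u : G, forall v : G,
     adj u v ==> @adj (forest_closure F) u v].

Definition has_forest_of_depth (m : nat) : bool :=
  [exists F : {ffun G -> option G},
     [&& rooted_forest F, spanning_in_closure F & forest_depth F == m]].

Lemma forest_exists : exists m, has_forest_of_depth m.
Proof.
pose s := enum G.
pose F : {ffun G -> option G} :=
  [ffun v => if index v s is i.+1 then Some (nth v s i) else None].
have step x y : parent_rel F x y -> index x s = (index y s).+1.
  rewrite /parent_rel /= ffunE; case E: (index x s) => [|i] //= /eqP[<-].
  rewrite index_uniq ?enum_uniq //.
  by apply: ltnW; rewrite -E index_mem mem_enum.
have up x y : connect (parent_rel F) x y -> index y s <= index x s.
  case/connectP=> q; elim: q x => [|z q IH] x /=; first by move=> _ ->.
  by case/andP=> /step -> /IH h /h /leqW.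
have down n : forall x y, index x s = n -> index y s <= n ->
    connect (parent_rel F) x y.
  elim: n => [|n IH] x y Ex.
    rewrite leqn0 => /eqP Ey; have <- // : x = y.
    by apply: (@index_inj _ x s); rewrite ?mem_enum // Ex Ey.
  rewrite leq_eqVlt => /orP[/eqP Ey|lt_yn].
    have <- // : x = y.
    by apply: (@index_inj _ x s); rewrite ?mem_enum // Ex Ey.
  have xz : parent_rel F x (nth x s n) by rewrite /parent_rel /= ffunE Ex.
  apply: connect_trans (connect1 xz) (IH _ _ _ lt_yn).
  by apply: succn_inj; rewrite -(step _ _ xz).
exists (forest_depth F); apply/existsP; exists F; rewrite eqxx andbT.
apply/andP; split.
  apply/forallP=> x; apply/forallP=> y; apply/implyP=> /step xy.
  by apply/negP=> /up; rewrite xy ltnn.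
apply/forallP=> u; apply/forallP=> v; apply/implyP=> uv /=.
have neq : u != v by apply: contraTneq uv => ->; rewrite adj_irr.
rewrite /closure_adj /ancestor /= neq /=.
by case/orP: (leq_total (index u s) (index v s)) => /(down _ _ _ erefl) ->;
   rewrite ?orbT.
Qed.

Definition treedepth : nat := ex_minn forest_exists.

End Treedepth.

Definition Kfree_treedepth_class (p k : nat) : graph_class :=
  fun G => Kfree p G /\ treedepth G <= k.

(* Main.v *)
Require Import Defs.
From mathcomp Require Import all_boot.
From Stdlib Require Import Classical.
Set Implicit Arguments.
Unset Strict Implicit.
Unset Printing Implicit Defensive.

(** Only the lower bound on the defective chromatic number has content.  Let
    [G] be a graph of the class with maximum chromatic number [n], embedded in
    the closure of a rooted forest [F].  Blow up [F] by giving every node [N]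
    copies of each of its children, recursively, and join two comparable nodes
    of the new forest when they are copies of adjacent vertices of [G].  The
    projection to [G] is injective on cliques and on root-to-node paths, so the
    blow-up is in the class.  Given a colouring of it with defect [d], select
    one copy of each vertex of [G], going down the forest: each of the at most
    [#|G|] ancestors already selected forbids at most [d] copies, so if
    [N > d * #|G|] a copy without conflict is left.  The selected copies give a
    proper colouring of [G], so at least [n] colours were used. *)

(** Lower the bound until it is attained. [P] need not be decidable, so each test is classical. *)
Lemma is_max_exists (P : nat -> Prop) (m b : nat) :
  P m -> (forall i, P i -> i <= b) -> exists n, is_max P n.
Proof.
move=> Pm; elim: b => [|b IHb] Pb.
  by exists m; split=> // i /Pb; rewrite leqn0 => /eqP ->.
case: (classic (P b.+1)) => [Pb1 | nPb1]; first by exists b.+1.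
apply: IHb => i Pi; have := Pb i Pi; rewrite leq_eqVlt => /orP[/eqP Ei | //].
by case: nPb1; rewrite -Ei.
Qed.

(** * Ancestors and depth in a rooted forest *)

Section Forests.
Variables (T : finType) (F : {ffun T -> option T}).
Hypothesis forestF : rooted_forest F.

Lemma ancestor_refl x : ancestor F x x. Proof. exact: connect0. Qed.

Lemma ancestor_trans x y z : ancestor F x y -> ancestor F y z -> ancestor F x z.
Proof. by move=> xy yz; apply: connect_trans yz xy. Qed.

Lemma parent_no_descendant x y : F x = Some y -> ~~ ancestor F x y.
Proof.
move=> Fx; move/forallP/(_ x)/forallP/(_ y)/implyP: forestF.
by rewrite /parent_rel /= Fx eqxx => /(_ isT).
Qed.

Lemma ancestor_parent x y z :
  F x = Some y -> ancestor F z x -> z = x \/ ancestor F z y.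
Proof.
move=> Fx /connectP[[|w q] /=]; first by move=> _ ->; left.
case/andP=> /eqP; rewrite Fx => -[<-] pq zE; right.
by apply/connectP; exists q.
Qed.

Lemma ancestor_step x z :
  ancestor F z x -> z = x \/ exists2 y, F x = Some y & ancestor F z y.
Proof.
case/connectP=> [[|y q] /=]; first by move=> _ ->; left.
case/andP=> /eqP Fx pq zE; right; exists y => //.
by apply/connectP; exists q.
Qed.

Lemma ancestor_anti x y : ancestor F x y -> ancestor F y x -> x = y.
Proof.
move=> /ancestor_step[// | [z Fy xz]] yx.
by have /negP[] := parent_no_descendant Fy; apply: ancestor_trans yx xz.
Qed.

(** Parents are unique, so the walk up from [x] is forced; whichever of [a] and [b] it meets first
    is a descendant of the other. *)
Lemma ancestor_total a b x :
  ancestor F a x -> ancestor F b x -> ancestor F a b || ancestor F b a.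
Proof.
case/connectP=> q; elim: q x => [|y q IHq] x /=.
  by move=> _ -> ->; rewrite orbT.
case/andP=> /eqP Fx pq aE /(ancestor_parent Fx)[-> | ].
  by apply/orP; left; apply/connectP; exists (y :: q); rewrite //= pq andbT; apply/eqP.
exact: IHq pq aE.
Qed.

Lemma vertex_depth_gt0 x : 0 < vertex_depth F x.
Proof. by apply/card_gt0P; exists x; rewrite inE ancestor_refl. Qed.

Lemma vertex_depth_lt x y :
  ancestor F x y -> x != y -> vertex_depth F x < vertex_depth F y.
Proof.
move=> xy neq; apply: proper_card; apply/properP; split.
  by apply/subsetP=> z; rewrite !inE => zx; apply: ancestor_trans zx xy.
exists y; rewrite !inE ?ancestor_refl //.
by apply: contra neq => /(ancestor_anti xy) ->.
Qed.

End Forests.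

(** * Treedepth and the chromatic number *)

Lemma treedepth_le (G : sgraph) (F : {ffun G -> option G}) (k : nat) :
  rooted_forest F -> spanning_in_closure F -> forest_depth F <= k ->
  treedepth G <= k.
Proof.
move=> fF sF; apply: leq_trans; rewrite /treedepth; case: ex_minnP => m _; apply.
by apply/existsP; exists F; rewrite fF sF eqxx.
Qed.

Lemma treedepth_forest (G : sgraph) (k : nat) :
  treedepth G <= k -> exists F : {ffun G -> option G},
    [/\ rooted_forest F, spanning_in_closure F & forest_depth F <= k].
Proof.
rewrite /treedepth; case: ex_minnP => m /existsP[F /and3P[fF sF /eqP Em]] _ mk.
by exists F; rewrite Em.
Qed.

Lemma spanning_ancestor (G : sgraph) (F : {ffun G -> option G}) (u v : G) :
  spanning_in_closure F -> adj u v -> ancestor F u v || ancestor F v u.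
Proof. by move=> /forallP/(_ u)/forallP/(_ v)/implyP sF /sF /andP[]. Qed.

Lemma proper_colouringP (G : sgraph) (k : nat) (c : colouring G k) :
  reflect (forall u v, adj u v -> c u != c v) (Defs.proper c).
Proof.
apply: (iffP forallP) => [h u v | h u].
  by move/(_ u)/forallP/(_ v)/implyP: h.
by apply/forallP => v; apply/implyP/h.
Qed.

Lemma chi_le (G : sgraph) (k : nat) :
  chi G <= k <-> exists c : colouring G k, Defs.proper c.
Proof.
rewrite /chi; case: ex_minnP => m /existsP[c /proper_colouringP pc] min_m.
split=> [mk | [c' pc']]; last by apply: min_m; apply/existsP; exists c'.
exists [ffun v => widen_ord mk (c v)]; apply/proper_colouringP=> u v uv.
by rewrite !ffunE; have := pc u v uv; apply: contra => /eqP [/val_inj ->].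
Qed.

(** Colour by depth, shifted by one since roots have depth 1: adjacent vertices are comparable,
    hence at different depths. *)
Lemma chi_le_treedepth (G : sgraph) : chi G <= treedepth G.
Proof.
apply/chi_le; have [F [fF sF dF]] := treedepth_forest (leqnn (treedepth G)).
have lt_depth v : (vertex_depth F v).-1 < treedepth G.
  by rewrite prednK ?vertex_depth_gt0 //; apply: leq_trans dF; exact: leq_bigmax.
exists [ffun v => Ordinal (lt_depth v)]; apply/proper_colouringP=> u v uv.
have neq : u != v by apply: contraTneq uv => ->; rewrite adj_irr.
rewrite !ffunE; apply/eqP=> -[] /(congr1 succn).
rewrite !prednK ?vertex_depth_gt0 // => Euv.
case/orP: (spanning_ancestor sF uv) => [uvF | vuF].
  by have := vertex_depth_lt fF uvF neq; rewrite Euv ltnn.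
by have := vertex_depth_lt fF vuF; rewrite eq_sym Euv ltnn => /(_ neq).
Qed.

(** * The blow-up and its membership in the class *)

Section Blowup.
Variables (G : sgraph) (F : {ffun G -> option G}) (N : nat).

(** The default [ord0] makes a copy of [v] depend only on the choices along the path from the root
    to [v]. *)
Definition truncate (v : G) (s : {ffun G -> 'I_N.+1}) : {ffun G -> 'I_N.+1} :=
  [ffun w => if ancestor F w v then s w else ord0].

(** The copies of [v] are the pairs [(v, truncate v s)]: [s w] says which copy
    of [w] is chosen below the chosen copy of its parent, for each ancestor [w]
    of [v].  A pair [(v, s)] with [truncate v s <> s] is a harmless extra
    leaf. *)
Definition blowup_parent :
    {ffun G * {ffun G -> 'I_N.+1} -> option (G * {ffun G -> 'I_N.+1})} :=
  [ffun x => omap (fun u => (u, truncate u x.2)) (F x.1)].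

Definition blowup_adj : rel (G * {ffun G -> 'I_N.+1}) :=
  [rel x y | adj x.1 y.1 &&
     (ancestor blowup_parent x y || ancestor blowup_parent y x)].

Lemma blowup_sym : symmetric blowup_adj.
Proof. by move=> x y; rewrite /blowup_adj /= adj_sym orbC. Qed.

Lemma blowup_irr : irreflexive blowup_adj.
Proof. by move=> x; rewrite /blowup_adj /= adj_irr. Qed.

Definition blowup : sgraph := SGraph blowup_sym blowup_irr.

Lemma truncate_truncate u v s :
  ancestor F u v -> truncate u (truncate v s) = truncate u s.
Proof.
move=> uv; apply/ffunP=> w; rewrite !ffunE; case: ifP => // wu.
by rewrite (ancestor_trans wu uv).
Qed.

Lemma blowup_parentP x y :
  blowup_parent x = Some y -> F x.1 = Some y.1.
Proof. by rewrite ffunE; case: (F x.1) => //= u [<-]. Qed.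

Lemma ancestor_fst x y : ancestor blowup_parent x y -> ancestor F x.1 y.1.
Proof.
case/connectP=> q; elim: q y => [|z q IHq] y /=; first by move=> _ ->; exact: connect0.
case/andP=> /eqP /blowup_parentP yz pq xE.
by apply: connect_trans (IHq z pq xE); apply: connect1; apply/eqP.
Qed.

(** Copies selected by one common [s] inherit comparability, so edges of [G] lift to edges between
    them. *)
Lemma ancestor_truncate u v s : ancestor F u v ->
  ancestor blowup_parent (u, truncate u s) (v, truncate v s).
Proof.
case/connectP=> q; elim: q v => [|w q IHq] v /=.
  by move=> _ ->; exact: connect0.
case/andP=> /eqP vw pq uE; apply: connect_trans (IHq w pq uE).
apply: connect1; rewrite /parent_rel /= ffunE /= vw /= truncate_truncate //.
by apply: connect1; apply/eqP.
Qed.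

Hypothesis forestF : rooted_forest F.

Lemma blowup_forest : rooted_forest blowup_parent.
Proof.
apply/forallP=> x; apply/forallP=> y; apply/implyP=> /eqP /blowup_parentP xy.
by apply: contra (parent_no_descendant forestF xy) => /ancestor_fst.
Qed.

(** Otherwise [b.1] would be an ancestor of its own parent. *)
Lemma ancestor_fst_inj a b :
  ancestor blowup_parent a b -> a.1 = b.1 -> a = b.
Proof.
case/ancestor_step=> // -[c /blowup_parentP bc /ancestor_fst ac] ab.
by have /negP[] := parent_no_descendant forestF bc; rewrite -ab.
Qed.

Lemma blowup_depth : forest_depth blowup_parent <= forest_depth F.
Proof.
apply/bigmax_leqP=> x _; apply: leq_trans (leq_bigmax x.1).
rewrite /vertex_depth -(@card_in_imset _ _ fst); last first.
  move=> a b; rewrite !inE => ax bx ab.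
  case/orP: (ancestor_total ax bx) => [/ancestor_fst_inj | h]; first exact.
  by apply/esym/ancestor_fst_inj.
by apply/subset_leq_card/subsetP=> u /imsetP[a]; rewrite !inE => /ancestor_fst ax ->.
Qed.

Lemma blowup_spanning : @spanning_in_closure blowup blowup_parent.
Proof.
apply/forallP=> x; apply/forallP=> y; apply/implyP=> xy.
have neq : x != y by apply: contraTneq xy => ->; rewrite adj_irr.
by case/andP: xy => _ xy; apply/andP.
Qed.

Lemma blowup_Kfree p : Kfree p G -> Kfree p blowup.
Proof.
move=> KG [f injf fadj]; apply: KG.
have fadj1 x y : @adj (complete_graph p) x y -> adj (f x).1 (f y).1.
  by move=> /fadj/andP[].
exists (fun x => (f x).1) => // x y Exy; apply/eqP/negPn/negP => /fadj1.
by rewrite Exy adj_irr.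
Qed.

Lemma blowup_class p k : Kfree p G -> forest_depth F <= k ->
  Kfree_treedepth_class p k blowup.
Proof.
move=> KG dF; split; first exact: blowup_Kfree.
exact: (@treedepth_le blowup _ _ blowup_forest blowup_spanning (leq_trans blowup_depth dF)).
Qed.

End Blowup.

(** * From a defective colouring of the blow-up to a proper colouring *)

Lemma defect_degree (G : sgraph) (k d : nat) (c : colouring G k) (v : G) :
  has_defect c d -> #|[set u | adj v u & c u == c v]| <= d.
Proof.
pose A := colour_class c (c v).
pose C := [set u in A | connect (induced_adj A) v u].
have vA : v \in A by rewrite inE.
have vC : v \in C by rewrite inE vA connect0.
move=> /(_ C) defc; apply: leq_trans (defc _); last first.
  by exists (c v); apply: imset_f.
apply: leq_trans (leq_bigmax_cond v vC).
apply/subset_leq_card/subsetP=> u; rewrite !inE => /andP[vu cu].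
rewrite vu cu andbT; apply: connect1.
by apply/and3P; split; rewrite // inE cu.
Qed.

Lemma blowup_proper_colouring (G : sgraph) (F : {ffun G -> option G})
    (k d : nat) (c : colouring (blowup F (d * #|G|)) k) :
  rooted_forest F -> spanning_in_closure F -> has_defect c d ->
  exists c' : colouring G k, Defs.proper c'.
Proof.
move=> fF sF defc; pose N := d * #|G|.
pose copy (s : {ffun G -> 'I_N.+1}) v : blowup F N := (v, truncate F v s).
pose good (s : {ffun G -> 'I_N.+1}) v :=
  forall a, adj a v -> ancestor F a v -> c (copy s a) != c (copy s v).
(* Induct over ancestor-closed sets [A], removing one vertex at a time. *)
suff main n (A : {set G}) : #|A| = n ->
    (forall u v, v \in A -> ancestor F u v -> u \in A) ->
    exists s, forall v, v \in A -> good s v.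
  have [//|s goods] := main _ [set: G] erefl.
  exists [ffun v => c (copy s v)]; apply/proper_colouringP=> u v uv; rewrite !ffunE.
  case/orP: (spanning_ancestor sF uv); first by apply: goods.
  by rewrite eq_sym; apply: goods; rewrite // adj_sym.
elim: n A => [|n IHn] A cardA upA.
  by exists [ffun=> ord0] => v; rewrite (cards0_eq cardA) inE.
have [v0 v0A] : exists v0, v0 \in A by apply/card_gt0P; rewrite cardA.
(* A deepest vertex has no proper descendant in [A]: removing it keeps [A] ancestor-closed, and
   changing [s] at [v] moves no other selected copy in [A]. *)
pose v := [arg max_(v > v0 in A) vertex_depth F v].
have [vA maxv] : v \in A /\ forall w, w \in A -> vertex_depth F w <= vertex_depth F v.
  by rewrite /v; case: arg_maxnP.
have leafv w : w \in A -> ancestor F v w -> w = v.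
  move=> wA vw; apply/eqP/negPn/negP; rewrite eq_sym => /(vertex_depth_lt fF vw).
  by rewrite ltnNge maxv.
have [||s goods] := IHn (A :\ v).
- by move: cardA; rewrite (cardsD1 v) vA => -[].
- move=> u w; rewrite !inE => /andP[wv wA] uw; rewrite (upA u w) // andbT.
  by apply: contra wv => /eqP Eu; rewrite Eu in uw; rewrite (leafv w).
pose upd i : {ffun G -> 'I_N.+1} := [ffun w => if w == v then i else s w].
have copy_upd i w : ~~ ancestor F v w -> copy (upd i) w = copy s w.
  move=> vw; congr (_, _); apply/ffunP=> u; rewrite !ffunE.
  by case: ifP => // uw; case: eqP => // Eu; rewrite -Eu uw in vw.
have strict a : adj a v -> ancestor F a v -> ~~ ancestor F v a.
  move=> av anc; apply/negP=> /(ancestor_anti fF anc) Ea.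
  by move: av; rewrite Ea adj_irr.
pose bad a := [set i | [&& adj a v, ancestor F a v &
                           c (copy (upd i) v) == c (copy s a)]].
have card_bad a : #|bad a| <= d.
  case: (boolP (adj a v && ancestor F a v)) => [/andP[av anc] | nav]; last first.
    rewrite (_ : bad a = set0) ?cards0 //.
    by apply/setP=> i; rewrite !inE andbA (negbTE nav).
  apply: leq_trans (defect_degree (copy s a) defc).
  (* Truncation at [v] keeps coordinate [v], so distinct [i] give distinct copies of [v]; the bad
     ones are neighbours of [copy s a] in its own colour. *)
  rewrite -(card_imset (bad a) (f := fun i => copy (upd i) v)); last first.
    move=> i j [] /ffunP/(_ v); rewrite !ffunE eqxx ancestor_refl; exact.
  apply/subset_leq_card/subsetP=> x /imsetP[i]; rewrite [i \in _]inE => /and3P[_ _ ci] ->.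
  rewrite inE ci andbT; apply/andP; split=> //; rewrite -(copy_upd i) ?strict //.
  by rewrite ancestor_truncate.
(* The bad sets cover at most [d * #|G|], that is [N], of the [N.+1] indices. *)
have [i goodi] : exists i, i \notin \bigcup_a bad a.
  apply/existsP; rewrite -negb_forall; apply/negP=> /forallP all_bad.
  have : #|\bigcup_a bad a| <= N.
    apply: leq_trans (_ : \sum_(a : G) d <= _); last by rewrite sum_nat_const mulnC.
    apply: (@leq_trans (\sum_a #|bad a|)); last by apply: leq_sum => a _; exact: card_bad.
    elim/big_rec2: _ => [|a m B _ IH]; first by rewrite cards0.
    by apply: leq_trans (leq_card_setU _ _) _; rewrite leq_add2l.
  rewrite (_ : \bigcup_a bad a = setT) ?cardsT ?card_ord ?ltnn //.
  by apply/setP=> i; rewrite all_bad inE.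
exists (upd i) => w wA a aw anc.
have [Ew | wv] := eqVneq w v.
  rewrite Ew in aw anc *; rewrite copy_upd ?strict // eq_sym.
  apply: contra goodi => ci; apply/bigcupP; exists a => //.
  by rewrite inE aw anc.
have nvw : ~~ ancestor F v w by apply: contra wv => /(leafv w wA) ->.
rewrite !copy_upd //; last by apply: contra nvw => va; apply: ancestor_trans va anc.
by apply: goods; rewrite // !inE wv.
Qed.

Lemma defective_chi_le (p k m d : nat) (G : sgraph) :
  (forall H, Kfree_treedepth_class p k H ->
     exists c : colouring H m, has_defect c d) ->
  Kfree_treedepth_class p k G -> chi G <= m.
Proof.
move=> colH [KG /treedepth_forest[F [fF sF dF]]]; apply/chi_le.
have [c defc] := colH _ (blowup_class (d * #|G|) fF KG dF).
exact: blowup_proper_colouring defc.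
Qed.

(** * Comparison of the three numbers *)

Lemma proper_clustering (G : sgraph) (k : nat) (c : colouring G k) :
  Defs.proper c -> has_clustering c 1.
Proof.
move=> /proper_colouringP pc C [i /imsetP[x _ ->]].
rewrite -(cards1 x); apply/subset_leq_card/subsetP=> y; rewrite !inE.
case/andP=> _ /connectP[[|z q] /=]; first by move=> _ ->.
case/andP=> /and3P[]; rewrite !inE => /eqP cx /eqP cz /pc.
by rewrite cx cz eqxx.
Qed.

Lemma clustering_defect (G : sgraph) (k s : nat) (c : colouring G k) :
  has_clustering c s -> has_defect c s.
Proof.
move=> clc C /clc; apply: leq_trans; apply/bigmax_leqP=> v _.
by apply/subset_leq_card/subsetP=> u; rewrite inE => /andP[].
Qed.

(** Shows the class is nonempty, so that the maximum of [chi] exists. *)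
Lemma null_graph_class (p k : nat) :
  0 < p -> Kfree_treedepth_class p k (complete_graph 0).
Proof.
move=> p_gt0; split; first by case=> f; case: (f (Ordinal p_gt0)).
pose F : {ffun complete_graph 0 -> option (complete_graph 0)} := [ffun=> None].
apply: (@treedepth_le _ F); try by apply/forallP=> -[].
by apply/bigmax_leqP=> -[].
Qed.

Theorem theorem9 (p k : nat) (hp : 3 <= p) (hk : 1 <= k) :
  exists n : nat,
    [/\ defective_chromatic_number (Kfree_treedepth_class p k) n,
        clustered_chromatic_number (Kfree_treedepth_class p k) n
      & chromatic_number (Kfree_treedepth_class p k) n].
Proof.
have [n maxn] : exists n, chromatic_number (Kfree_treedepth_class p k) n.
  apply: (@is_max_exists _ (chi (complete_graph 0)) k) => [|m [G [_ tdG] <-]].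
    by exists (complete_graph 0) => //; apply: null_graph_class; apply: leq_trans hp.
  exact: leq_trans (chi_le_treedepth G) tdG.
have [[G clsG chiG] chi_max] := maxn.
have colH H : Kfree_treedepth_class p k H ->
    exists c : colouring H n, has_clustering c 1.
  move=> clsH; have /chi_le[c /proper_clustering clc] : chi H <= n.
    by apply: chi_max; exists H.
  by exists c.
(* Applied to a graph [G] attaining the maximum, this one lower bound serves both minima, as
   clustering [s] implies defect [s]. *)
have min_n m d : (forall H, Kfree_treedepth_class p k H ->
    exists c : colouring H m, has_defect c d) -> n <= m.
  by move=> /defective_chi_le/(_ clsG); rewrite chiG.
exists n; split=> //; split.
- by exists 1 => H /colH[c /clustering_defect]; exists c.
- by move=> m [d /min_n].
- by exists 1.
- move=> m [s cls]; apply: (min_n m s) => H /cls[c /clustering_defect defc].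
  by exists c.
Qed.
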